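(* Let $\alpha$ be a (real) algebraic number such that $\alpha > 1$. If $\alpha$ is not an algebraic integer, then the additive monoid $\mathbb{N}_0[\alpha]$ is densely elastic; that is, its set of elasticities $R(\mathbb{N}_0[\alpha])$ is dense in $\mathbb{R}_{\ge 1}$.
   Context: $\mathbb{N}_0$ denotes the nonnegative integers. Algebraic numbers are algebraic over $\mathbb{Q}$. For a positive real $\alpha$, $\mathbb{N}_0[\alpha] := \{f(\alpha) \mid f(X) \in \mathbb{N}_0[X]\}$, where $\mathbb{N}_0[X]$ is the set of polynomials with coefficients in $\mathbb{N}_0$; it is regarded as an additive submonoid of $\mathbb{R}_{\ge 0}$. Let $M$ be a cancellative commutative monoid, written additively, whose only invertible element is $0$, and let $M^\bullet = M \setminus \{0\}$. An atom of $M$ is a nonzero $a \in M$ such that $a = b + c$ with $b, c \in M$ implies $b = 0$ or $c = 0$. $M$ is atomic if every nonzero element is a finite sum of atoms. For $M$ atomic and $x \in M^\bullet$, $\mathsf{L}(x)$ is the set of all $\ell \in \mathbb{N}_0$ such that $x = a_1 + \dots + a_\ell$ for some atoms $a_1, \dots, a_\ell$ (repetitions allowed). The elasticity of $x$ is $\rho(x) := \sup \mathsf{L}(x) / \min \mathsf{L}(x)$ (equal to $\infty$ if $\mathsf{L}(x)$ is unbounded). The set of elasticities of $M$ is $R(M) := \{\rho(x) \mid x \in M^\bullet\}$. For $\alpha > 1$ the monoid $\mathbb{N}_0[\alpha]$ is atomic, so these notions apply. *)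

(* Defs.v *)
From HB Require Import structures.
From mathcomp Require Import all_boot all_order all_algebra.
From mathcomp Require Import all_classical all_reals all_analysis.
Import Order.TTheory GRing.Theory Num.Theory.
Import numFieldNormedType.Exports.

Set Implicit Arguments.
Unset Strict Implicit.
Unset Printing Implicit Defensive.

Local Open Scope classical_set_scope.
Local Open Scope ring_scope.

(* The monoids considered are additive submonoids [M] of an ambient additive
   monoid [V], given by their carrier sets; they are meant to be cancellative
   and reduced (no invertible element but 0), as any submonoid of the
   nonnegative reals is. *)

Definition atom (V : nmodType) (M : set V) (a : V) : Prop :=
  [/\ M a, a != 0 &
      forall b c : V, M b -> M c -> a = b + c -> b = 0 \/ c = 0].

Definition lengths (V : nmodType) (M : set V) (x : V) : set nat :=
  [set l | exists a : 'I_l -> V,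
             (forall i, atom M (a i)) /\ x = \sum_(i < l) a i].

(* The default value 0 is used only when [L] is empty. *)
Definition set_min (L : set nat) : nat :=
  xget 0%N [set m | L m /\ forall l, L l -> (m <= l)%N].

(* The supremum is taken in the extended reals, so that the elasticity is +oo
   when the set of lengths is unbounded. *)
Definition elasticity (R : realType) (V : nmodType) (M : set V) (x : V)
    : \bar R :=
  (ereal_sup [set (l%:R)%:E | l in lengths M x]
     * ((set_min (lengths M x))%:R^-1)%:E)%E.

Definition elasticities (R : realType) (V : nmodType) (M : set V)
    : set (\bar R) :=
  [set elasticity R M x | x in M `\ 0].

(* Only finite elasticities can approximate a real number, so density in
   [1, +oo[ concerns the real-valued part of the set of elasticities. *)
Definition densely_elastic (R : realType) (V : nmodType) (M : set V) : Prop :=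
  [set t : R | 1 <= t] `<=` closure [set r : R | elasticities M r%:E].

Definition nat_adjoin (R : realType) (alpha : R) : set R :=
  range (fun f : {poly nat} => (map_poly (fun n : nat => n%:R) f).[alpha]).

(* Main.v *)
Require Import Defs.
From HB Require Import structures.
From mathcomp Require Import all_boot all_order all_algebra.
From mathcomp Require Import all_classical all_reals all_analysis.
From mathcomp Require Import zify lra.
Import Order.TTheory GRing.Theory Num.Theory.
Import numFieldNormedType.Exports.
Set Implicit Arguments.
Unset Strict Implicit.
Local Open Scope classical_set_scope.
Local Open Scope ring_scope.

(** As [alpha] is not an algebraic integer, no power of [alpha] is a sum of
smaller powers, so the atoms of [N_0[alpha]] are exactly the powers
[alpha ^+ n].  A factorization is therefore a finite multiset of exponents,
that is a sequence [s : seq nat] up to order; its length is [size s] and the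
element that it factors is [pow_sum alpha s].  Since [alpha > 1], the length
is at most the element, and each set of lengths has a minimum [b] and a
maximum [a].

Two mechanisms give density.

- Large elasticities ([large_ratio_factorizations]): dividing an annihilating
  polynomial by the largest possible power of [X - 1], one gets an integer
  polynomial that vanishes at [alpha] but not at [1].  Its positive and negative parts are two
  factorizations of one element with different lengths.  Multiplying
  factorizations as polynomials multiplies both elements and lengths, so
  taking powers makes the ratio of the two lengths as large as desired.

- Fine interpolation ([extremal_lengths_succ]): if [alpha ^+ N] exceeds [x],
  then every factorization of [alpha ^+ N + x] uses the atom [alpha ^+ N].
  Otherwise, comparing it with a factorization of [x] followed by [N] would
  give an integer polynomial relation whose highest power of [alpha] has
  coefficient [1] or [-1].  Hence the extremal lengths [(b, a)] become
  [(b + 1, a + 1)].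

Starting from [a / b] very large, the elasticities [(a + k) / (b + k)]
decrease to [1].  The step across a target [t] has size about
[(t - 1) / (b + k)], and [b + k] is large when the ratio gets down to [t],
because [a] is ([ratio_approx]). *)

(** * Factorizations as sequences of exponents *)

Definition pow_sum (R : realType) (alpha : R) (s : seq nat) : R :=
  \sum_(i <- s) alpha ^+ i.

Lemma pow_sum_nil (R : realType) (alpha : R) : pow_sum alpha [::] = 0.
Proof. exact: big_nil. Qed.

Lemma pow_sum_cons (R : realType) (alpha : R) i s :
  pow_sum alpha (i :: s) = alpha ^+ i + pow_sum alpha s.
Proof. exact: big_cons. Qed.

Lemma pow_sum_cat (R : realType) (alpha : R) s t :
  pow_sum alpha (s ++ t) = pow_sum alpha s + pow_sum alpha t.
Proof. exact: big_cat. Qed.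

Lemma pow_sum_rem (R : realType) (alpha : R) i s : i \in s ->
  pow_sum alpha s = alpha ^+ i + pow_sum alpha (rem i s).
Proof.
by move=> si; rewrite /pow_sum (perm_big _ (perm_to_rem si)) big_cons.
Qed.

Lemma pow_sum_mul (R : realType) (alpha : R) s t :
  pow_sum alpha [seq (i + j)%N | i <- s, j <- t] =
  pow_sum alpha s * pow_sum alpha t.
Proof.
rewrite /pow_sum big_allpairs_dep mulr_suml; apply: eq_bigr => i _.
by rewrite mulr_sumr; apply: eq_bigr => j _; rewrite exprD.
Qed.

Lemma pow_sum_flatten_nseq (R : realType) (alpha : R) (c : nat -> nat) n :
  pow_sum alpha (flatten [seq nseq (c i) i | i <- iota 0 n]) =
  \sum_(i < n) (c i)%:R * alpha ^+ i.
Proof.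
rewrite /pow_sum big_flatten big_map -[in LHS](subn0 n) -/(index_iota 0 n).
rewrite big_mkord; apply: eq_bigr => i _.
by rewrite big_nseq -Monoid.iteropE /= -/(GRing.natmul _ _) mulr_natl.
Qed.

Lemma size_flatten_nseq (c : nat -> nat) n :
  size (flatten [seq nseq (c i) i | i <- iota 0 n]) = (\sum_(i < n) c i)%N.
Proof.
rewrite size_flatten sumnE !big_map -[in LHS](subn0 n) -/(index_iota 0 n).
by rewrite big_mkord; apply: eq_bigr => i _; rewrite size_nseq.
Qed.

Lemma pow_sum_ge0 (R : realType) (alpha : R) s : 1 < alpha ->
  0 <= pow_sum alpha s.
Proof.
move=> a1; apply: sumr_ge0 => i _.
by rewrite exprn_ge0 // ltW // (lt_trans ltr01).
Qed.

Lemma exp_le_pow_sum (R : realType) (alpha : R) i s : 1 < alpha -> i \in s ->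
  alpha ^+ i <= pow_sum alpha s.
Proof. by move=> a1 si; rewrite (pow_sum_rem _ si) lerDl pow_sum_ge0. Qed.

Lemma size_le_pow_sum (R : realType) (alpha : R) s : 1 < alpha ->
  (size s)%:R <= pow_sum alpha s.
Proof.
move=> a1; elim: s => [|i s IHs]; first by rewrite pow_sum_nil.
by rewrite pow_sum_cons /= -add1n natrD lerD // exprn_ege1 // ltW.
Qed.

(** A polynomial with coefficients in [nat] is the multiset of exponents in
which [i] is repeated as often as its [i]-th coefficient. *)
Lemma nat_adjoinE (R : realType) (alpha : R) :
  nat_adjoin alpha = range (pow_sum alpha).
Proof.
apply/seteqP; split => x [f _ <-].
  exists (flatten [seq nseq (nth 0%N f i) i | i <- iota 0 (size f)]) => //.
  rewrite pow_sum_flatten_nseq (@horner_coef_wide _ (size f)) ?size_poly //.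
  by apply: eq_bigr => i _; rewrite coef_map_id0.
pose g := fun s : seq nat => \sum_(i <- s) 'X^i : {poly nat}.
exists (g f) => //; elim: f => [|i s IHs].
  by rewrite /g big_nil map_poly0 // horner0 pow_sum_nil.
rewrite /g big_cons -/(g s) pow_sum_cons -IHs.
have -> : map_poly (fun n : nat => n%:R : R) ('X^i + g s) =
    'X^i + map_poly (fun n : nat => n%:R) (g s).
  apply/polyP => j.
  by rewrite coefD !coef_map_id0 // coefD natrD !coefXn; case: eqP.
by rewrite hornerD hornerXn.
Qed.

(** * Atoms and lengths *)

Lemma size_sum_polyXn (s : seq nat) n : all (ltn^~ n) s ->
  (size (\sum_(i <- s) 'X^i : {poly int})%R <= n)%N.
Proof.
move=> sn; apply: leq_trans (size_sum _ _ _) _.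
rewrite big_seq_cond; apply/bigmax_leqP_seq => i _ /andP[/(allP sn) + _].
by rewrite size_polyXn.
Qed.

(** The only use of non-integrality: such an equality would be the vanishing at
[alpha] of a monic polynomial of degree [n] with integer coefficients. *)
Lemma no_monic_relation (R : realType) (alpha : R) (n : nat) (s t : seq nat) :
  ~ integralOver (intr : int -> R) alpha ->
  all (ltn^~ n) s -> all (ltn^~ n) t ->
  alpha ^+ n + pow_sum alpha s <> pow_sum alpha t.
Proof.
move=> hni sn tn e; apply: hni.
exists ('X^n + (\sum_(i <- s) 'X^i - \sum_(i <- t) 'X^i)).
  rewrite monicE lead_coefDl ?lead_coefXn // size_polyXn ltnS.
  apply: leq_trans (size_polyD _ _) _.
  by rewrite size_polyN geq_max !size_sum_polyXn.
have ev u : (map_poly (intr : int -> R) (\sum_(i <- u) 'X^i)).[alpha] =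
    pow_sum alpha u.
  rewrite rmorph_sum /= horner_sum; apply: eq_bigr => i _.
  by rewrite map_polyXn hornerXn.
rewrite rootE rmorphD rmorphB /= map_polyXn hornerD hornerXn hornerD hornerN.
by rewrite !ev addrA e subrr.
Qed.

(** A nonzero element has some [alpha ^+ i] as a summand, so an atom is a
power.  Conversely a factorization of [alpha ^+ n] must use an exponent
[j >= n] by [no_monic_relation]; as [alpha ^+ n <= alpha ^+ j], nothing is left
besides this [j], and one of the two summands is empty. *)
Lemma atom_nat_adjoinE (R : realType) (alpha a : R) : 1 < alpha ->
  ~ integralOver (intr : int -> R) alpha ->
  atom (nat_adjoin alpha) a <-> exists n, a = alpha ^+ n.
Proof.
move=> a1 hni; rewrite nat_adjoinE; split.
  case=> [[s _ <-]]; case: s => [|i s]; first by rewrite pow_sum_nil eqxx.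
  move=> _ irr; exists i.
  have [| |eq0|s0] := irr _ _ _ _ (pow_sum_cons alpha i s).
  - by exists [:: i] => //; rewrite pow_sum_cons pow_sum_nil addr0.
  - by exists s.
  - move: (expf_eq0 alpha i).
    by rewrite eq0 eqxx gt_eqF ?andbF // (lt_trans ltr01).
  - by rewrite pow_sum_cons s0 addr0.
move=> [n ->]; split.
- by exists [:: n] => //; rewrite pow_sum_cons pow_sum_nil addr0.
- by rewrite expf_neq0 // gt_eqF // (lt_trans ltr01).
move=> _ _ [s _ <-] [t _ <-]; rewrite -pow_sum_cat => e.
have [st|/allPn[j jst]] := boolP (all (ltn^~ n) (s ++ t)).
  case: (@no_monic_relation _ alpha n [::] (s ++ t)) => //.
  by rewrite pow_sum_nil addr0.
rewrite -leqNgt => nj.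
have le_nj : alpha ^+ n <= alpha ^+ j by rewrite ler_eXn2l.
have r0 := pow_sum_ge0 (rem j (s ++ t)) a1.
have /eqP := e; rewrite (pow_sum_rem _ jst) => /eqP e'.
have sz0 : (size (rem j (s ++ t)))%:R <= 0 :> R.
  by apply: le_trans (size_le_pow_sum _ a1) _; lra.
move: sz0; rewrite lern0 size_rem // size_cat.
case: s {e jst r0 e'} => [|i s]; first by left; rewrite pow_sum_nil.
by case: t => [|k t]; [right; rewrite pow_sum_nil | rewrite /= addnS].
Qed.

Lemma lengths_nat_adjoinE (R : realType) (alpha x : R) : 1 < alpha ->
  ~ integralOver (intr : int -> R) alpha ->
  lengths (nat_adjoin alpha) x =
  [set size s | s in [set s | pow_sum alpha s = x]].
Proof.
move=> a1 hni; apply/seteqP; split => l.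
  move=> [a [/(_ _)/(atom_nat_adjoinE _ a1 hni) ata ->]].
  have /choice[e ae] := ata.
  exists [seq e i | i <- enum 'I_l]; last by rewrite size_map size_enum_ord.
  by rewrite /= /pow_sum big_map big_enum; apply: eq_bigr => i _; rewrite -ae.
move=> [s /= <- <-].
exists (fun i : 'I_(size s) => alpha ^+ (nth 0%N s i)); split.
  by move=> i; apply/(atom_nat_adjoinE _ a1 hni); exists (nth 0%N s i).
by rewrite /pow_sum (big_nth 0%N) big_mkord.
Qed.

Lemma seq_max (s : seq nat) : s != [::] ->
  exists2 m, m \in s & all (leq^~ m) s.
Proof.
elim: s => // i s IHs _; have [-> | /IHs[m ms sm]] := eqVneq s [::].
  by exists i; rewrite ?mem_head //= leqnn.
have [im|mi] := leqP i m.
  by exists m; rewrite ?inE ?ms ?orbT //= im.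
exists i; rewrite ?mem_head //= leqnn.
by apply: sub_all sm => j /leq_trans; apply; apply: ltnW.
Qed.

(** Suppose that [N] does not occur in [u].  If all exponents of [u] are below
[N], then [alpha ^+ N] is the highest power in the relation and occurs once.
Otherwise the highest power is [alpha ^+ m] with [m > N] the maximum of [u]; it
also occurs only once, since twice [alpha ^+ m] would exceed
[alpha ^+ N + pow_sum alpha s].  Both cases contradict [no_monic_relation]. *)
Lemma big_power_in_factorization (R : realType) (alpha : R) (N : nat)
    (s u : seq nat) :
  1 < alpha -> ~ integralOver (intr : int -> R) alpha ->
  pow_sum alpha s < alpha ^+ N ->
  pow_sum alpha u = alpha ^+ N + pow_sum alpha s -> N \in u.
Proof.
move=> a1 hni sN e; apply: contraT => Nu.
have all_sN : all (ltn^~ N) s.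
  apply/allP => i /(exp_le_pow_sum a1)/le_lt_trans/(_ sN).
  by rewrite ltr_eXn2l.
have [uN|/allPn[j ju]] := boolP (all (ltn^~ N) u).
  by case: (@no_monic_relation _ alpha N s u).
rewrite -leqNgt leq_eqVlt => /orP[/eqP Nj|Nj].
  by rewrite -Nj (negPf Nu) in ju.
have [|m mu um] := @seq_max u; first by apply: contraTneq ju => ->.
have Nm : (N < m)%N := leq_trans Nj (allP um _ ju).
have le_Nm : alpha ^+ N <= alpha ^+ m by rewrite ler_eXn2l // ltnW.
have e' := e; rewrite (pow_sum_rem _ mu) in e'.
have [mr|mr] := boolP (m \in rem m u).
  by have le_mr := exp_le_pow_sum a1 mr; exfalso; lra.
case: (@no_monic_relation _ alpha m (rem m u) (N :: s)) => //.
- apply/allP => i iu /=; rewrite ltn_neqAle (allP um) ?(mem_rem iu) // andbT.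
  by apply: contraNneq mr => im; rewrite -{1}im.
- apply/andP; split; first exact: Nm.
  by apply: sub_all all_sN => i iN; apply: ltn_trans iN Nm.
- by rewrite pow_sum_cons.
Qed.

(** * Extremal lengths *)

Lemma exists_lt_exp (R : realType) (alpha x : R) : 1 < alpha ->
  exists N, x < alpha ^+ N.
Proof.
move=> a1; have bern n : 1 + n%:R * (alpha - 1) <= alpha ^+ n.
  elim: n => [|n IHn]; first by rewrite mul0r addr0 expr0.
  have n0 : 0 <= n%:R * (alpha - 1) ^+ 2 by rewrite mulr_ge0 ?sqr_ge0.
  (* With n0, this is the induction step of Bernoulli's inequality. *)
  have : alpha * (1 + n%:R * (alpha - 1)) <= alpha * alpha ^+ n.
    by rewrite ler_pM2l // (lt_trans ltr01).
  by rewrite exprS -natr1; lra.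
exists (Num.truncn (x / (alpha - 1))).+1; apply: lt_le_trans (bern _).
by have := truncnS_gt (x / (alpha - 1)); rewrite ltr_pdivrMr ?subr_gt0 //; lra.
Qed.

(** When [alpha] is not an algebraic integer, these are the extreme elements of
the set of lengths of [x], so that [a / b] is its elasticity. *)
Definition extremal_lengths (R : realType) (alpha x : R) (b a : nat) : Prop :=
  let L := [set size s | s in [set s | pow_sum alpha s = x]] in
  [/\ L b, L a & forall l, L l -> (b <= l <= a)%N].

Lemma extremal_lengths_exist (R : realType) (alpha : R) (s : seq nat) :
  1 < alpha -> exists b a, extremal_lengths alpha (pow_sum alpha s) b a.
Proof.
move=> a1; set x := pow_sum alpha s.
pose L := [set size u | u in [set u | pow_sum alpha u = x]].
have exL : exists l, `[< L l >] by exists (size s); apply/asboolP; exists s.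
have ubL l : `[< L l >] -> (l <= Num.truncn x)%N.
  move=> /asboolP[u /= us <-]; rewrite truncn_ge_nat ?pow_sum_ge0 //.
  by rewrite -us size_le_pow_sum.
case: (ex_minnP exL) => b /asboolP Lb minb.
case: (ex_maxnP exL ubL) => a /asboolP La maxa.
exists b, a; split => // l Ll.
by apply/andP; split; [apply: minb | apply: maxa]; apply/asboolP.
Qed.

(** The witness is [alpha ^+ N + x] for [alpha ^+ N] larger than [x]: removing
one [N] turns its factorizations into those of [x], and adding [N] is the
inverse operation. *)
Lemma extremal_lengths_succ (R : realType) (alpha x : R) (b a : nat) :
  1 < alpha -> ~ integralOver (intr : int -> R) alpha ->
  extremal_lengths alpha x b a ->
  exists y, extremal_lengths alpha y b.+1 a.+1.
Proof.
move=> a1 hni [[s /= sx sb] [t /= tx ta] ext].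
have [N xN] : exists N, x < alpha ^+ N.
  exact: exists_lt_exp.
exists (alpha ^+ N + x); split.
- by exists (N :: s); rewrite /= ?sb // pow_sum_cons sx.
- by exists (N :: t); rewrite /= ?ta // pow_sum_cons tx.
move=> _ [u /= ux <-].
have Nu : N \in u.
  by apply: (@big_power_in_factorization _ alpha N s u) => //; rewrite sx.
have /ext : [set size v | v in [set v | pow_sum alpha v = x]] (size (rem N u)).
  exists (rem N u) => //=; apply: (addrI (alpha ^+ N)).
  by rewrite -pow_sum_rem.
by rewrite size_rem //; case: u Nu {ux}.
Qed.

Lemma extremal_lengths_addn (R : realType) (alpha x : R) (b a k : nat) :
  1 < alpha -> ~ integralOver (intr : int -> R) alpha ->
  extremal_lengths alpha x b a ->
  exists y, extremal_lengths alpha y (k + b) (k + a).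
Proof.
move=> a1 hni ext; elim: k => [|k [y IHk]]; first by exists x.
exact: extremal_lengths_succ IHk.
Qed.

Lemma elasticity_extremal (R : realType) (alpha x : R) (b a : nat) :
  1 < alpha -> ~ integralOver (intr : int -> R) alpha -> (0 < b)%N ->
  extremal_lengths alpha x b a ->
  elasticities (nat_adjoin alpha) (a%:R / b%:R : R)%:E.
Proof.
move=> a1 hni b0 [Lb La ext]; exists x.
  case: Lb => s /= sx sb; split; first by rewrite nat_adjoinE; exists s.
  apply/eqP; rewrite -sx gt_eqF //; apply: lt_le_trans (size_le_pow_sum _ a1).
  by rewrite ltr0n sb.
rewrite /elasticity lengths_nat_adjoinE //.
pose L := [set size s | s in [set s | pow_sum alpha s = x]]; rewrite -/L.
have -> : set_min L = b.
  apply: xget_unique; first by split=> // l /ext /andP[].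
  move=> m [/ext/andP[bm _] minm]; apply/eqP.
  by rewrite eqn_leq bm minm.
suff -> : ereal_sup [set l%:R%:E | l in L] = (a%:R)%:E :> \bar R by [].
apply/le_anti/andP; split.
  by apply: ge_ereal_sup => _ [l /ext/andP[_ la] <-]; rewrite lee_fin ler_nat.
by apply: le_ereal_sup_tmp; exists (a%:R)%:E => //; exists a.
Qed.

(** * Elements with large elasticity *)

(** The factorizations are the positive and negative parts of an integer
polynomial [h] with [h(alpha) = 0] and [h(1) <> 0]; the difference of their
lengths is [h(1)] up to sign. *)
Lemma unequal_factorizations (R : realType) (alpha : R) :
  algebraicOver (ratr : rat -> R) alpha -> 1 < alpha ->
  exists s t, pow_sum alpha s = pow_sum alpha t /\ (size s < size t)%N.
Proof.
move=> [p p0 pa] a1.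
have [q [c c0 pq]] := rat_poly_scale p.
have q0 : q != 0.
  by apply: contraNneq p0 => q0; rewrite pq q0 map_poly0 scaler0.
have qa : root (map_poly (intr : int -> R) q) alpha.
  move: pa; rewrite pq map_polyZ rootZ /=.
    by rewrite -map_poly_comp (eq_map_poly (ratr_int _)).
  by rewrite fmorph_eq0 invr_eq0 intr_eq0.
(* As alpha <> 1, removing all factors 'X - 1 keeps alpha as a root. *)
have [m [h]] := multiplicity_XsubC q 1.
rewrite q0 /= => h1 qh.
have ha : (map_poly (intr : int -> R) h).[alpha] = 0.
  move: qa; rewrite qh rmorphM rmorphXn rmorphB /= map_polyX map_polyC /=.
  rewrite rootM => /orP[/rootP //|].
  by rewrite rootE horner_exp expf_eq0 hornerXsubC subr_eq0 gt_eqF ?andbF.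
pose pos i : nat := if (0 <= h`_i)%R then `|(h`_i)%R|%N else 0%N.
pose neg i : nat := if (0 <= h`_i)%R then 0%N else `|(h`_i)%R|%N.
have hE i : h`_i = (pos i)%:Z - (neg i)%:Z.
  by rewrite /pos /neg; case: ifP; lia.
pose n := size h.
pose s := flatten [seq nseq (pos i) i | i <- iota 0 n].
pose t := flatten [seq nseq (neg i) i | i <- iota 0 n].
have st : pow_sum alpha s = pow_sum alpha t.
  rewrite (@horner_coef_wide _ n) ?size_poly // in ha.
  apply/subr0_eq; rewrite !pow_sum_flatten_nseq -sumrB -[RHS]ha.
  apply: eq_bigr => i _.
  by rewrite coef_map /= hE rmorphB /= mulrBl.
have sz : size s != size t.
  apply: contraNneq h1; rewrite !size_flatten_nseq => e.
  rewrite rootE horner_coef (eq_bigr (fun i : 'I_n => (pos i)%:Z - (neg i)%:Z)).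
    by rewrite sumrB -!(big_morph Posz PoszD erefl) e subrr.
  by move=> i _; rewrite expr1n mulr1 hE.
case: (ltngtP (size s) (size t)) sz => // lt _; first by exists s, t.
by exists t, s.
Qed.

(** Lengths [p < q] of one element become [p ^ n] and [q ^ n] for its [n]-th
power, and [(q / p) ^ n >= 1 + n / p] is at least [T] once [n = T * p]. *)
Lemma large_ratio_factorizations (R : realType) (alpha : R) (T : nat) :
  algebraicOver (ratr : rat -> R) alpha -> 1 < alpha ->
  exists s t, [/\ pow_sum alpha s = pow_sum alpha t, (0 < size s)%N &
                  (T * size s <= size t)%N].
Proof.
move=> halg a1; have [s [t [st lt_st]]] := unequal_factorizations halg a1.
have s0 : (0 < size s)%N.
  rewrite lt0n; apply: contraTneq lt_st => /size0nil s0; rewrite -leqNgt.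
  have := size_le_pow_sum t a1; rewrite -st s0 pow_sum_nil lern0 => /eqP -> //.
have pows (u : seq nat) n : exists v, pow_sum alpha v = pow_sum alpha u ^+ n /\
    size v = (size u ^ n)%N.
  elim: n => [|n [v [vu sv]]].
    by exists [:: 0%N]; rewrite pow_sum_cons pow_sum_nil addr0.
  exists [seq (i + j)%N | i <- u, j <- v].
  by rewrite pow_sum_mul size_allpairs vu sv exprS expnS.
(* This is Bernoulli's inequality for (size t / size s) ^ n, multiplied by
   size s ^ n.+1. *)
have bern n : ((size s + n) * size s ^ n <= size s * size t ^ n)%N.
  elim: n => [|n IHn]; first by rewrite addn0.
  rewrite !expnS.
  set X := (size s ^ n)%N in IHn *; set Y := (size t ^ n)%N in IHn *.
  move: (size s) (size t) s0 lt_st IHn => a b; clearbody X Y => a0 ab IH.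
  have h1 : (a.+1 * ((a + n) * X) <= b * (a * Y))%N by apply: leq_mul.
  apply: leq_trans (_ : (b * (a * Y) <= _)%N); last by rewrite mulnCA.
  apply: leq_trans h1; nia.
have [v [vs szv]] := pows s (T * size s)%N.
have [w [wt szw]] := pows t (T * size s)%N.
exists v, w; split; first by rewrite vs wt st.
  by rewrite szv expn_gt0 s0.
rewrite szv szw -(leq_pmul2l s0); apply: leq_trans (bern _).
by rewrite mulnCA mulnA leq_mul2r; apply/orP; right; lia.
Qed.

(** * Approximation by shifted ratios *)

(** Take the least [k] with [(k + a) / (k + b) < u], where [u = t + e]; then
[k > 0] because [T >= u].  The previous ratio is at least [u], so [k + a] is at
least [u * (k + b) - (u - 1)], and this exceeds [(t - e) * (k + b)] when
[t < e * (k + b)].  The latter follows from [u * (k + b) > k + a >= T], as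
[T >= u * (t / e)]. *)
Lemma ratio_approx (R : realType) (t e : R) : 1 <= t -> 0 < e ->
  exists T : nat, forall b a : nat, (0 < b)%N -> (T * b <= a)%N ->
  exists k : nat, `|t - (k + a)%:R / (k + b)%:R| < e.
Proof.
move=> t1 e0; pose u := t + e; have u1 : 1 < u by rewrite /u; lra.
pose T := (Num.truncn (u + u * (t / e))).+1.
have T_gt : u + u * (t / e) < T%:R by exact: truncnS_gt.
have te0 : 0 <= t / e by rewrite divr_ge0 // ltW // (lt_le_trans ltr01).
exists T => b a b0 Tba.
have {Tba} Tba : T%:R * b%:R <= a%:R :> R by rewrite -natrM ler_nat.
have b1 : 1 <= b%:R :> R by rewrite ler1n.
have exk : exists k : nat, (k + a)%:R < u * (k + b)%:R.
  exists (Num.truncn (a%:R / (u - 1))).+1; set k := _.+1.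
  have : a%:R / (u - 1) < k%:R by exact: truncnS_gt.
  rewrite ltr_pdivrMr ?subr_gt0 // !natrD; nra.
case: (ex_minnP exk) => k ak mink; exists k.
have kb0 : 0 < (k + b)%:R :> R by rewrite ltr0n; lia.
have kb_large : t < e * (k + b)%:R.
  have : u * (t / e) < u * (k + b)%:R.
    apply: lt_trans ak.
    have k0 : 0 <= k%:R :> R by [].
    have Ta : T%:R <= a%:R :> R by apply: le_trans Tba; rewrite ler_peMr.
    by rewrite natrD; lra.
  by rewrite ltr_pM2l ?(lt_trans ltr01) // ltr_pdivrMr // mulrC.
have lower : (t - e) * (k + b)%:R < (k + a)%:R.
  (* For k = 0 the choice of T contradicts the choice of k. *)
  case: k mink ak kb0 kb_large => [|k] mink.
    have uT : u <= T%:R.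
      apply: le_trans (ltW T_gt).
      by rewrite lerDl mulr_ge0 // ltW // (lt_trans ltr01).
    have : u * b%:R <= T%:R * b%:R by rewrite ler_wpM2r.
    by rewrite !add0n /u; move=> *; nra.
  have := contraNN (mink k); rewrite -ltnNge ltnSn -leNgt => /(_ isT).
  have ekb : 0 <= e * (k + b)%:R by rewrite mulr_ge0 // ltW.
  by rewrite !addSn -!natr1 /u => *; nra.
have : (t - e) < (k + a)%:R / (k + b)%:R by rewrite ltr_pdivlMr.
have : (k + a)%:R / (k + b)%:R < t + e by rewrite ltr_pdivrMr.
by rewrite ltr_norml; lra.
Qed.

Theorem proposition4p5 (R : realType) (alpha : R)
    (halg : algebraicOver (ratr : rat -> R) alpha)
    (hgt1 : 1 < alpha)
    (hnint : ~ integralOver (intr : int -> R) alpha) :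
  densely_elastic R (nat_adjoin alpha).
Proof.
move=> t /= t1 B /nbhs_ballP[e /= e0 teB].
have [T approx] := ratio_approx t1 e0.
have [s [s' [ss s0 Ts]]] := large_ratio_factorizations T halg hgt1.
have [b [a ext]] := extremal_lengths_exist s hgt1.
have [[u /= us ub] _ bnd] := ext.
have /andP[b_le _] := bnd (size s) (ex_intro2 _ _ s erefl erefl).
have /andP[_ le_a] := bnd (size s') (ex_intro2 _ _ s' (esym ss) erefl).
have b0 : (0 < b)%N.
  rewrite lt0n -ub; apply: contraTneq s0 => /size0nil u0; rewrite -leqNgt.
  have := size_le_pow_sum s hgt1.
  by rewrite -us u0 pow_sum_nil lern0 => /eqP ->.
have [k close] : exists k : nat, `|t - (k + a)%:R / (k + b)%:R| < e.
  apply: approx => //; apply: leq_trans le_a; apply: leq_trans Ts.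
  by rewrite leq_mul2l b_le orbT.
have [y exty] := extremal_lengths_addn k hgt1 hnint ext.
exists ((k + a)%:R / (k + b)%:R); split; last exact: teB.
by apply: elasticity_extremal exty => //; rewrite addn_gt0 b0 orbT.
Qed.
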